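(* Consider the KLQ program with subspace relaxation $$J^\star(\nu_0^0)=\min_{\nu,\gamma}\ \sum_{k=1}^K\mathcal D(\nu_k,\nu_k^0)+\frac{\kappa}{2}\sum_{n=1}^N\gamma_n^2$$ subject to $\gamma_n=\sum_{k=1}^K w_n(k)\langle\nu_k,\mathcal Y\rangle-\hat r_n$ for $1\le n\le N$, and $\sum_{u'}\nu_k(s',u')=\sum_{s,u}\nu_{k-1}(s,u)T_{k-1}((s,u),s')$ for $1\le k\le K$, $s'\in\mathsf S$, with $\nu_0=\nu_0^0$. Let $\varphi^\star(\lambda,g)$ be its dual function. Then there exists a maximizer $\{\lambda_n^\star,g_k^\star:1\le n\le N,\ 1\le k\le K\}$ of $\varphi^\star$, and there is no duality gap: $$\varphi^\star(\lambda^\star,g^\star)=J^\star(\nu_0^0).$$ The optimal policy is obtained from $\{g_k^\star\}$ via $$\phi_k^\star(u\mid s)=\phi_k^0(u\mid s)\exp\Big(\sum_{s'}T_k((s,u),s')\,g_{k+1}^\star(s')+\check\lambda_k^\star\,\mathcal Y(s,u)-g_k^\star(s)\Big),$$ where $g_k^\star(s)=\mathcal T_k^{\lambda^\star}(g_{k+1}^\star;s)$ for $1\le k\le K$, $g_{K+1}^\star\equiv0$, and $\check\lambda_k^\star=\sum_{n=1}^N\lambda_n^\star w_n(k)$.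
   Context: $\mathsf S$ and $\mathsf U$ are finite sets and $\mathsf X=\mathsf S\times\mathsf U$, $x=(s,u)$. Fix integers $K,N\ge1$, a constant $\kappa>0$, $\mathcal Y:\mathsf X\to\mathbb R$, a reference signal $r_1,\dots,r_K\in\mathbb R$, functions $w_n:\{0,1,\dots,K\}\to\mathbb R$ ($1\le n\le N$), $\hat r_n=\sum_{k=1}^Kw_n(k)r_k$, controlled transition matrices $T_k$ ($T_k(x,\cdot)$ a pmf on $\mathsf S$), an initial pmf $\nu_0^0$ on $\mathsf X$, and nominal randomized policies $\phi_k^0(u\mid s)$, $1\le k\le K$ (for each $s$ a pmf on $\mathsf U$); $\nu_k^0$ are the corresponding nominal marginals. $\langle\nu,\mathcal Y\rangle=\sum_x\nu(x)\mathcal Y(x)$. The minimum is over pmfs $\nu_k$ on $\mathsf X$ and $\gamma_n\in\mathbb R$. With $\phi_k$ the conditional pmf $\nu_k(s,u)=\phi_k(u\mid s)\sum_{u'}\nu_k(s,u')$, $$\mathcal D(\nu_k,\nu_k^0)=\sum_{s,u}\nu_k(s,u)\log\Big(\frac{\phi_k(u\mid s)}{\phi_k^0(u\mid s)}\Big)$$ (usual relative-entropy conventions). The policy associated with $\nu$ is $\{\phi_k\}$. For $\lambda\in\mathbb R^N$ and $g=(g_1,\dots,g_K)$ with $g_k:\mathsf S\to\mathbb R$, the Lagrangian is $$\mathcal L(\nu,\gamma,\lambda,g)=\sum_{k=1}^K\mathcal D(\nu_k,\nu_k^0)+\frac{\kappa}{2}\sum_{n=1}^N\gamma_n^2+\sum_{n=1}^N\lambda_n\Big(\gamma_n+\sum_{k=1}^Kw_n(k)[r_k-\langle\nu_k,\mathcal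 Y\rangle]\Big)+\sum_{k=1}^K\sum_{s'}\Big(\sum_{u'}\nu_k(s',u')-\sum_{s,u}\nu_{k-1}(s,u)T_{k-1}((s,u),s')\Big)g_k(s'),$$ with $\nu_0=\nu_0^0$ fixed, and the dual function is $\varphi^\star(\lambda,g)=\min_{\nu,\gamma}\mathcal L(\nu,\gamma,\lambda,g)$, the minimum being over all pmfs $\nu_1,\dots,\nu_K$ on $\mathsf X$ and $\gamma\in\mathbb R^N$. For $f:\mathsf S\to\mathbb R$, $\lambda\in\mathbb R^N$, $$\mathcal T_k^\lambda(f;s)=\log\Big(\sum_u\phi_k^0(u\mid s)\exp\Big(\sum_{s'}T_k((s,u),s')f(s')+\check\lambda_k\mathcal Y(s,u)\Big)\Big),\qquad \check\lambda_k=\sum_{n=1}^N\lambda_nw_n(k).$$ *)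

(* Defs.v *)
From mathcomp Require Import all_boot all_order all_algebra.
From mathcomp Require Import all_classical all_reals all_analysis.

Set Implicit Arguments.
Unset Strict Implicit.
Unset Printing Implicit Defensive.

Import Order.TTheory GRing.Theory Num.Theory.

Local Open Scope classical_set_scope.
Local Open Scope ring_scope.

(* Time-indexed data are families over nat.  Only the following indices matter:
   1..K for nu, phi0, g, r and w n; 0..K for T.  In addition, nu 0 carries the
   fixed initial pmf and g (K+1) the terminal convention g_{K+1} = 0. *)

Definition is_pmf (R : realType) (A : finType) (p : A -> R) : Prop :=
  (forall a, 0 <= p a) /\ \sum_a p a = 1.

Definition mean (R : realType) (X : finType) (nu Y : X -> R) : R :=
  \sum_x nu x * Y x.

Definition state_marginal (R : realType) (S U : finType) (nu : S * U -> R)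
    (s : S) : R :=
  \sum_u nu (s, u).

(* At a state of zero marginal the quotient is 0 by the convention x / 0 = 0;
   such states carry no weight in the divergence below. *)
Definition cond_pmf (R : realType) (S U : finType) (nu : S * U -> R)
    (s : S) (u : U) : R :=
  nu (s, u) / state_marginal nu s.

(* m * log (p / q), with 0 * log (p / q) = 0 for all p, q, and
   m * log (p / 0) = +oo for m != 0. *)
Definition entropy_term (R : realType) (m p q : R) : \bar R :=
  if m == 0 then 0%E else if q == 0 then +oo%E else (m * ln (p / q))%:E.

(* The reference marginal enters the divergence only through its conditional
   pmf phi0, which is part of the data, including at states that the reference
   marginal does not charge. *)
Definition divergence (R : realType) (S U : finType) (phi0 : S -> U -> R)
    (nu : S * U -> R) : \bar R :=
  (\sum_s \sum_u entropy_term (nu (s, u)) (cond_pmf nu s u) (phi0 s u))%E.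

Definition rhat (R : realType) (K N : nat) (w : 'I_N -> nat -> R)
    (r : nat -> R) (n : 'I_N) : R :=
  \sum_(1 <= k < K.+1) w n k * r k.

Definition lambda_check (R : realType) (N : nat) (w : 'I_N -> nat -> R)
    (lam : 'rV[R]_N) (k : nat) : R :=
  \sum_(n < N) lam ord0 n * w n k.

Definition flow (R : realType) (S U : finType) (T : nat -> S * U -> S -> R)
    (nu : nat -> S * U -> R) (k : nat) (s' : S) : R :=
  \sum_x nu k.-1 x * T k.-1 x s'.

Definition admissible (R : realType) (S U : finType) (K : nat)
    (nu00 : S * U -> R) (nu : nat -> S * U -> R) : Prop :=
  nu 0%N =1 nu00 /\ forall k, (1 <= k <= K)%N -> is_pmf (nu k).

Definition objective (R : realType) (S U : finType) (K N : nat) (kappa : R)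
    (phi0 : nat -> S -> U -> R) (nu : nat -> S * U -> R) (gam : 'rV[R]_N) :
    \bar R :=
  (\sum_(1 <= k < K.+1) divergence (phi0 k) (nu k)
   + (kappa / 2 * \sum_(n < N) gam ord0 n ^+ 2)%R%:E)%E.

Definition feasible (R : realType) (S U : finType) (K N : nat)
    (Y : S * U -> R) (r : nat -> R) (w : 'I_N -> nat -> R)
    (T : nat -> S * U -> S -> R) (nu00 : S * U -> R)
    (nu : nat -> S * U -> R) (gam : 'rV[R]_N) : Prop :=
  [/\ admissible K nu00 nu,
      forall n, gam ord0 n
        = \sum_(1 <= k < K.+1) w n k * mean (nu k) Y - rhat K w r n
    & forall k s', (1 <= k <= K)%N ->
        state_marginal (nu k) s' = flow T nu k s'].

Definition primal_value (R : realType) (S U : finType) (K N : nat) (kappa : R)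
    (Y : S * U -> R) (r : nat -> R) (w : 'I_N -> nat -> R)
    (T : nat -> S * U -> S -> R) (phi0 : nat -> S -> U -> R)
    (nu00 : S * U -> R) : \bar R :=
  ereal_inf [set v | exists nu gam,
    feasible K Y r w T nu00 nu gam /\ v = objective K kappa phi0 nu gam].

Definition primal_optimal (R : realType) (S U : finType) (K N : nat)
    (kappa : R) (Y : S * U -> R) (r : nat -> R) (w : 'I_N -> nat -> R)
    (T : nat -> S * U -> S -> R) (phi0 : nat -> S -> U -> R)
    (nu00 : S * U -> R) (nu : nat -> S * U -> R) (gam : 'rV[R]_N) : Prop :=
  feasible K Y r w T nu00 nu gam /\
  objective K kappa phi0 nu gam = primal_value K kappa Y r w T phi0 nu00.

Definition lagrangian (R : realType) (S U : finType) (K N : nat) (kappa : R)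
    (Y : S * U -> R) (r : nat -> R) (w : 'I_N -> nat -> R)
    (T : nat -> S * U -> S -> R) (phi0 : nat -> S -> U -> R)
    (nu : nat -> S * U -> R) (gam : 'rV[R]_N)
    (lam : 'rV[R]_N) (g : nat -> S -> R) : \bar R :=
  (objective K kappa phi0 nu gam
   + (\sum_(n < N) lam ord0 n *
        (gam ord0 n + \sum_(1 <= k < K.+1) w n k * (r k - mean (nu k) Y)))%R%:E
   + (\sum_(1 <= k < K.+1) \sum_s'
        (state_marginal (nu k) s' - flow T nu k s') * g k s')%R%:E)%E.

Definition dual_function (R : realType) (S U : finType) (K N : nat)
    (kappa : R) (Y : S * U -> R) (r : nat -> R) (w : 'I_N -> nat -> R)
    (T : nat -> S * U -> S -> R) (phi0 : nat -> S -> U -> R)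
    (nu00 : S * U -> R) (lam : 'rV[R]_N) (g : nat -> S -> R) : \bar R :=
  ereal_inf [set v | exists nu gam,
    admissible K nu00 nu /\
    v = lagrangian K kappa Y r w T phi0 nu gam lam g].

Definition bellman (R : realType) (S U : finType) (N : nat)
    (Y : S * U -> R) (w : 'I_N -> nat -> R) (T : nat -> S * U -> S -> R)
    (phi0 : nat -> S -> U -> R) (lam : 'rV[R]_N) (k : nat)
    (f : S -> R) (s : S) : R :=
  ln (\sum_u phi0 k s u *
        expR (\sum_s' T k (s, u) s' * f s' + lambda_check w lam k * Y (s, u))).

Definition tilted_policy (R : realType) (S U : finType) (N : nat)
    (Y : S * U -> R) (w : 'I_N -> nat -> R) (T : nat -> S * U -> S -> R)
    (phi0 : nat -> S -> U -> R) (lam : 'rV[R]_N) (g : nat -> S -> R)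
    (k : nat) (s : S) (u : U) : R :=
  phi0 k s u *
  expR (\sum_s' T k (s, u) s' * g k.+1 s'
        + lambda_check w lam k * Y (s, u) - g k s).

(* nu determines its policy only at states of positive marginal, hence the
   product form. *)
Definition has_policy (R : realType) (S U : finType) (K : nat)
    (nu : nat -> S * U -> R) (phi : nat -> S -> U -> R) : Prop :=
  forall k s u, (1 <= k <= K)%N ->
    nu k (s, u) = phi k s u * state_marginal (nu k) s.

(* Main.v *)
Require Import Defs.
From mathcomp Require Import all_boot all_order all_algebra.
From mathcomp Require Import all_classical all_reals all_analysis.
From mathcomp Require Import ring lra.

Set Implicit Arguments.
Unset Strict Implicit.
Unset Printing Implicit Defensive.

Import Order.TTheory GRing.Theory Num.Theory.
Import numFieldNormedType.Exports.

Local Open Scope classical_set_scope.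
Local Open Scope ring_scope.

(** The proof rests on one exact identity.  For multipliers [(lam, g)] let
    [g_{K+1} = 0], let [B_k] be the Bellman value of [g_{k+1}], and let [q_k] be
    the nominal policy tilted by [exp (T_k g_{k+1} + lam_k Y)] and normalized,
    with normalizing constant [exp B_k].  Moving the tilt from the nominal policy
    into the divergence, telescoping the flow terms and completing the square in
    [gam] gives, for all pmfs [nu_k] ([lagrangian_decomposition]),
      L = sum_k D(nu_k || q_k) + sum_k sum_s nu_k(s) (g_k(s) - B_k(s))
          + kappa/2 |gam + lam/kappa|^2 + c(lam, g_1).
    The divergences are nonnegative and vanish exactly when [nu_k] has the policy
    [q_k] ([divergence_ge0], [divergence_eq0]).  So the minimum defining the dual
    function is attained by [gam = - lam/kappa] and by [nu_k] with the policy
    [q_k] whose state marginal is concentrated where [g_k - B_k] is smallest.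

    If [g] solves the backward recursion [g_k = B_k], the second sum is zero.  The
    minimum over [nu] is then attained at every family with policies [q_k],
    in particular at the closed loop, the family that also satisfies the flow
    constraints, and the dual function takes the value
    [reduced_dual lam = c(lam, g_1)].

    It remains to choose [lam] so that the closed loop together with
    [gam = - lam/kappa] is primal feasible.  The reduced dual is continuous and
    dominated by a concave quadratic ([reduced_dual_coercive]), hence has a
    maximizer.  The first-order condition there comes from a comparison of values:
    along the flow constraints the Lagrangian is affine in [lam] and independent
    of [g], so comparing the minimum at [lam] with the value of the Lagrangian at
    the closed loop of [lam + d] gives
      reduced_dual lam + d . h(lam + d) <= reduced_dual (lam + d),
    where [h(lam)] is the residual of the constraint on [gam] at the closed loop
    of [lam].  At a maximizer [d . h(lam + d) <= 0] for all [d], and the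
    continuity of [h] forces [h(lam) = 0] ([continuous_stationary]), which is the
    missing feasibility.  Strong duality follows by weak duality, and a primal
    optimizer minimizes the Lagrangian, so all its divergences vanish and it has
    the tilted policy. *)

(** * Continuity and finite-dimensional optimization *)

Section Continuity.
Context (R : realType) (V : topologicalType).
Implicit Types f g : V -> R.

Lemma sumr_continuous (I : Type) (r : seq I) (F : I -> V -> R) :
  (forall i, continuous (F i)) -> continuous (fun x => \sum_(i <- r) F i x).
Proof. by move=> cF; apply: continuous_big => //; exact: add_continuous. Qed.

Lemma addr_continuous f g :
  continuous f -> continuous g -> continuous (fun x => f x + g x).
Proof. by move=> cf cg x; apply: cvgD; [exact: cf|exact: cg]. Qed.

Lemma oppr_continuous f : continuous f -> continuous (fun x => - f x).
Proof. by move=> cf x; apply: cvgN; exact: cf. Qed.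

Lemma mulr_continuous f g :
  continuous f -> continuous g -> continuous (fun x => f x * g x).
Proof. by move=> cf cg x; apply: cvgM; [exact: cf|exact: cg]. Qed.

Lemma expR_comp_continuous f : continuous f -> continuous (fun x => expR (f x)).
Proof.
by move=> cf x; apply: continuous_comp; [exact: cf|exact: continuous_expR].
Qed.

Lemma ln_comp_continuous f :
  (forall x, 0 < f x) -> continuous f -> continuous (fun x => ln (f x)).
Proof.
by move=> f0 cf x; apply: continuous_comp; [exact: cf|exact: continuous_ln].
Qed.

End Continuity.

(** The superlevel set of [f 0] lies in a compact box: completing the squares in
    the bound confines [v] to a ball of radius [c |a|]. *)
Lemma coercive_attains_max (R : realType) n (f : 'rV[R]_n -> R) (a : 'I_n -> R)
    (c : R) :
  0 < c -> continuous f ->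
  (forall v, f v <= f 0 + \sum_i (v ord0 i * a i - v ord0 i ^+ 2 / c)) ->
  exists v, forall v', f v' <= f v.
Proof.
move=> c0 cf fle.
(* [x ^ 2 <= t] implies [|x| <= 1 + t], which avoids a square root. *)
pose M := 1 + c ^+ 2 * \sum_i a i ^+ 2.
have M1 : 1 <= M.
  by rewrite lerDl mulr_ge0 ?sqr_ge0// sumr_ge0// => i _; exact: sqr_ge0.
pose box : set 'rV[R]_n := [set v | forall i, `[- M, M]%classic (v ord0 i)].
have box0 : box 0.
  by move=> i; rewrite /= in_itv/= mxE; apply/andP; split; lra.
have out v : f 0 <= f v -> box v.
  move=> f0v i; rewrite /= in_itv/= -ler_norml.
  have sq : \sum_j v ord0 j ^+ 2 <= c ^+ 2 * \sum_j a j ^+ 2.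
    have : 0 <= \sum_j (v ord0 j * a j - v ord0 j ^+ 2 / c).
      by rewrite -(lerD2l (f 0)) addr0 (le_trans f0v).
    rewrite -(pmulr_rge0 _ (mulr_gt0 (ltr0n R 2) c0)) => h.
    rewrite mulr_sumr in h; rewrite mulr_sumr -subr_ge0 -sumrB (le_trans h)//.
    apply: ler_sum => j _.
    rewrite -subr_ge0.
    rewrite (_ : _ - _ = (c * a j - v ord0 j) ^+ 2) ?sqr_ge0//.
    by field; rewrite lt0r_neq0.
  have : v ord0 i ^+ 2 <= M - 1.
    rewrite /M addrAC subrr add0r (le_trans _ sq)// (bigD1 i)//= lerDl.
    by rewrite sumr_ge0// => j _; exact: sqr_ge0.
  rewrite -real_normK ?num_real//; have := normr_ge0 (v ord0 i).
  nra.
have [|||v _ vmax] := @EVT_max_rV R n f box; first by exists 0.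
- apply: (@rV_compact _ _ (fun=> `[- M, M]%classic)) => i.
  exact: segment_compact.
- exact: continuous_subspaceT.
exists v => v'; have [f0v|/ltW vf0] := leP (f 0) (f v').
  by apply: vmax; rewrite inE; exact: out.
by apply: (le_trans vf0); apply: vmax; rewrite inE.
Qed.

(** If [h v] were nonzero, take for [d] a small positive multiple of it: by
    continuity the pairing of [h v] with [h (v + d)] is close to [|h v| ^ 2] and
    hence positive. *)
Lemma continuous_stationary (R : realType) n (h : 'I_n -> 'rV[R]_n -> R)
    (v : 'rV[R]_n) :
  (forall i, continuous (h i)) ->
  (forall d : 'rV[R]_n, \sum_i d ord0 i * h i (v + d) <= 0) ->
  forall i, h i v = 0.
Proof.
move=> ch hle i; apply/eqP/negPn/negP => hi.
pose d : 'rV[R]_n := \row_j h j v.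
pose psi (e : R) : R := \sum_j h j v * h j (v + e *: d).
have cline : continuous (fun e : R => v + e *: d).
  by move=> e; apply: cvgD; [exact: cvg_cst|apply: cvgZr_tmp; exact: cvg_id].
have cpsi : continuous psi.
  apply: sumr_continuous => j; apply: mulr_continuous => e; first exact: cvg_cst.
  by apply: continuous_comp; [exact: cline|exact: ch].
have psi0 : 0 < psi 0.
  rewrite /psi (bigD1 i)//= scale0r addr0 -expr2 ltr_pwDl//.
    by rewrite lt_neqAle eq_sym sqrf_eq0 hi sqr_ge0.
  by rewrite sumr_ge0// => j _; rewrite -expr2 sqr_ge0.
have /nbhs_ballP[e /= e0 he] : \forall e \near 0, 0 < psi e.
  exact: (@cvgr_gt R R (nbhs (0 : R)) _ psi (psi 0) (cpsi 0)).
have e2 : 0 < e / 2 by rewrite divr_gt0.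
have : 0 < psi (e / 2).
  apply: he; rewrite /ball/= sub0r normrN gtr0_norm//.
  by rewrite ltr_pdivrMr// ltr_pMr// ltr1n.
apply/negP; rewrite -leNgt -(pmulr_rle0 _ e2).
apply: le_trans (hle (e / 2 *: d)); rewrite mulr_sumr.
by apply: ler_sum => j _; rewrite !mxE mulrA.
Qed.

(** * Relative entropy against a policy *)

Lemma sume_eq0 (R : realType) (I : eqType) (r : seq I) (F : I -> \bar R) :
  (forall i, i \in r -> 0 <= F i)%E -> (\sum_(i <- r) F i = 0)%E ->
  forall i, i \in r -> F i = 0%E.
Proof.
elim: r => [//|j r IH] F0; rewrite big_cons => /eqP.
have F0r i : i \in r -> (0 <= F i)%E by move=> ir; rewrite F0// inE ir orbT.
rewrite padde_eq0; [|by rewrite F0// mem_head|by rewrite big_seq sume_ge0].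
by move=> /andP[/eqP Fj /eqP Fr] i /[!inE] /predU1P[->//|]; exact: IH.
Qed.

(** Tilting the reference by [expR a] preserves its zeros, so the identity also
    holds when both sides are infinite. *)
Lemma entropy_term_tilt (R : realType) (m p q a : R) :
  (m != 0 -> 0 < p) -> 0 <= q ->
  entropy_term m p q = (entropy_term m p (q * expR a) + (m * a)%:E)%E.
Proof.
move=> hp q0; rewrite /entropy_term.
case: (eqVneq m 0) => [->|m0]; first by rewrite mul0r adde0.
rewrite mulf_eq0 (negPf (lt0r_neq0 (expR_gt0 a))) orbF.
case: (eqVneq q 0) => [//|qn0].
have qp : 0 < q by rewrite lt_neqAle eq_sym qn0.
rewrite -EFinD !ln_div ?posrE ?mulr_gt0 ?expR_gt0 ?hp//.
by rewrite lnM ?posrE ?expR_gt0// expRK; congr EFin; ring.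
Qed.

(** Gibbs' inequality before summation: [1 + y < expR y] for [y != 0], applied to
    [y = - ln (m / M / q)].  Keeping the slack term by term, rather than only the
    sign of the sum, is what gives the equality case of the divergence. *)
Lemma entropy_term_slack (R : realType) (m M q : R) :
  0 <= m -> 0 <= M -> (m != 0 -> M != 0) -> 0 <= q ->
  ((m - q * M)%:E <= entropy_term m (m / M) q)%E /\
  (entropy_term m (m / M) q = (m - q * M)%:E -> m = q * M).
Proof.
move=> m0 M0 hM q0; rewrite /entropy_term.
case: (eqVneq m 0) => [->|mn0].
  rewrite sub0r lee_fin oppr_le0 mulr_ge0//; split=> // -[] /eqP.
  by rewrite eq_sym oppr_eq0 => /eqP ->.
case: (eqVneq q 0) => [->|qn0]; first by rewrite leey.
have mp : 0 < m by rewrite lt_neqAle eq_sym mn0.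
have qp : 0 < q by rewrite lt_neqAle eq_sym qn0.
have Mp : 0 < M by rewrite lt_neqAle eq_sym (hM mn0).
set y := ln _.
have ey : q * M = m * expR (- y).
  rewrite expRN /y lnK ?posrE ?divr_gt0//; field.
  by rewrite !lt0r_neq0.
rewrite ey lee_fin; split.
  by have := expR_ge1Dx (- y); nra.
case=> e; have [->|yn0] := eqVneq y 0; first by rewrite oppr0 expR0 mulr1.
have /expR_gt1Dx : - y != 0 by rewrite oppr_eq0.
by nra.
Qed.

Section Divergence.
Context (R : realType) (S U : finType).
Implicit Types (nu : S * U -> R) (phi : S -> U -> R).

Lemma le_state_marginal nu s u :
  (forall x, 0 <= nu x) -> nu (s, u) <= state_marginal nu s.
Proof.
by move=> h; rewrite /state_marginal (bigD1 u)//= lerDl sumr_ge0.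
Qed.

Lemma state_marginal_ge0 nu s :
  (forall x, 0 <= nu x) -> 0 <= state_marginal nu s.
Proof. by move=> h; rewrite sumr_ge0. Qed.

Lemma state_marginal_neq0 nu s u :
  (forall x, 0 <= nu x) -> nu (s, u) != 0 -> state_marginal nu s != 0.
Proof.
move=> h n0; rewrite gt_eqF//.
by rewrite (lt_le_trans _ (le_state_marginal s u h))// lt_neqAle eq_sym n0 h.
Qed.

Lemma sum_state_marginal nu : \sum_s state_marginal nu s = \sum_x nu x.
Proof. by rewrite pair_big/=; apply: eq_bigr => -[]. Qed.

Lemma divergence_tilt phi (a : S -> U -> R) nu :
  (forall x, 0 <= nu x) -> (forall s u, 0 <= phi s u) ->
  divergence phi nu
  = (divergence (fun s u => phi s u * expR (a s u))%R nu
     + (\sum_s \sum_u nu (s, u) * a s u)%R%:E)%E.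
Proof.
move=> nu0 phi_ge0; rewrite /divergence -sumEFin -big_split/=.
apply: eq_bigr => s _; rewrite -sumEFin -big_split/=.
apply: eq_bigr => u _; apply: entropy_term_tilt => // n0.
by rewrite divr_gt0// lt_neqAle eq_sym ?n0 ?nu0// state_marginal_ge0
  ?(state_marginal_neq0 nu0 n0).
Qed.

(** The correction sums to zero over [u] for every policy [phi], so it makes each
    term nonnegative without changing the divergence. *)
Let slack phi nu s u : \bar R :=
  (entropy_term (nu (s, u)) (cond_pmf nu s u) (phi s u)
   + (phi s u * state_marginal nu s - nu (s, u))%R%:E)%E.

Lemma divergence_slack phi nu :
  (forall s, is_pmf (phi s)) ->
  divergence phi nu = (\sum_s \sum_u slack phi nu s u)%E.
Proof.
move=> hphi; apply: eq_bigr => s _.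
by rewrite big_split/= sumEFin sumrB -mulr_suml (hphi s).2 mul1r subrr adde0.
Qed.

Lemma slack_ge0 phi nu s u :
  (forall s, is_pmf (phi s)) -> (forall x, 0 <= nu x) ->
  (0 <= slack phi nu s u)%E.
Proof.
move=> hphi nu0.
have [le _] := entropy_term_slack (nu0 (s, u)) (state_marginal_ge0 s nu0)
  (@state_marginal_neq0 nu s u nu0) ((hphi s).1 u).
by rewrite /slack -opprB EFinN sube_ge0// fin_numE.
Qed.

Lemma divergence_ge0 phi nu :
  (forall s, is_pmf (phi s)) -> (forall x, 0 <= nu x) ->
  (0 <= divergence phi nu)%E.
Proof.
move=> hphi nu0; rewrite divergence_slack//.
by apply: sume_ge0 => s _; apply: sume_ge0 => u _; exact: slack_ge0.
Qed.

Lemma divergence_eq0 phi nu :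
  (forall s, is_pmf (phi s)) -> (forall x, 0 <= nu x) ->
  divergence phi nu = 0%E <->
  (forall s u, nu (s, u) = phi s u * state_marginal nu s).
Proof.
move=> hphi nu0; split=> [|h].
  rewrite divergence_slack// => h s u.
  have /sume_eq0 h' : (\sum_v slack phi nu s v = 0)%E.
    apply: (sume_eq0 _ h (mem_index_enum s)) => s' _.
    by apply: sume_ge0 => v _; exact: slack_ge0.
  have [_ eq] := entropy_term_slack (nu0 (s, u)) (state_marginal_ge0 s nu0)
    (@state_marginal_neq0 nu s u nu0) ((hphi s).1 u).
  have := h' (fun v _ => slack_ge0 s v hphi nu0) u (mem_index_enum u).
  rewrite /slack => e0; apply: eq; move: e0; rewrite /cond_pmf.
  case: (entropy_term _ _ _) => [e|//|//] [] e0.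
  by congr EFin; lra.
rewrite /divergence big1// => s _; rewrite big1// => u _.
rewrite /entropy_term; case: eqP => // /eqP n0.
have := n0; rewrite h mulf_eq0 negb_or => /andP[p0 M0].
have -> : cond_pmf nu s u = phi s u by rewrite /cond_pmf h mulfK.
by rewrite (negPf p0) divff// ln1 mulr0.
Qed.

End Divergence.

(** * The Bellman operator and the policy it normalizes *)

Section Gibbs.
Context (R : realType) (S U : finType) (N : nat) (Y : S * U -> R)
  (w : 'I_N -> nat -> R) (T : nat -> S * U -> S -> R)
  (phi0 : nat -> S -> U -> R).
Implicit Types (lam : 'rV[R]_N) (f : S -> R) (k : nat).

Definition tilt lam k f s u : R :=
  \sum_s' T k (s, u) s' * f s' + lambda_check w lam k * Y (s, u).

Definition bellman_policy lam k f s u : R :=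
  phi0 k s u * expR (tilt lam k f s u - bellman Y w T phi0 lam k f s).

Lemma partition_gt0 (p c : U -> R) :
  is_pmf p -> 0 < \sum_u p u * expR (c u).
Proof.
move=> [p0 p1].
have ge0 u : 0 <= p u * expR (c u) by rewrite mulr_ge0 ?expR_ge0.
rewrite lt_neqAle eq_sym sumr_ge0 ?andbT//; apply/negP => /eqP.
move/psumr_eq0P => h.
have /eqP := p1; rewrite big1 ?(eq_sym 0) ?oner_eq0// => u _.
have /eqP := h (fun u _ => ge0 u) u isT.
by rewrite mulf_eq0 (gt_eqF (expR_gt0 _)) orbF => /eqP.
Qed.

Lemma bellman_policy_pmf lam k f s :
  is_pmf (phi0 k s) -> is_pmf (bellman_policy lam k f s).
Proof.
move=> hp; have Z0 := partition_gt0 (tilt lam k f s) hp.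
split=> [u|]; first by rewrite mulr_ge0 ?expR_ge0// hp.1.
rewrite -[RHS](divff (lt0r_neq0 Z0)) mulr_suml; apply: eq_bigr => u _.
by rewrite /bellman_policy expRD expRN lnK ?posrE// mulrA.
Qed.

Lemma tilted_policyE lam (g : nat -> S -> R) k s u :
  g k s = bellman Y w T phi0 lam k (g k.+1) s ->
  tilted_policy Y w T phi0 lam g k s u = bellman_policy lam k (g k.+1) s u.
Proof. by rewrite /tilted_policy => ->. Qed.

(** Variational form of the Bellman operator: the logarithm of the tilt is linear
    in [nu k], and integrating it produces the flow into the next step, the mean
    of [Y] and the Bellman value. *)
Lemma divergence_bellman lam k f (nu : nat -> S * U -> R) :
  (forall x, 0 <= nu k x) -> (forall s, is_pmf (phi0 k s)) ->
  divergence (phi0 k) (nu k)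
  = (divergence (bellman_policy lam k f) (nu k)
     + (\sum_s' flow T nu k.+1 s' * f s' + lambda_check w lam k * mean (nu k) Y
        - \sum_s state_marginal (nu k) s * bellman Y w T phi0 lam k f s)%R%:E)%E.
Proof.
move=> nu0 hp.
rewrite (@divergence_tilt _ _ _ _
  (fun s u => tilt lam k f s u - bellman Y w T phi0 lam k f s))//; last first.
  by move=> s u; exact: (hp s).1.
congr (_ + _%:E)%E.
under eq_bigr do under eq_bigr do rewrite mulrBr.
under eq_bigr do rewrite sumrB.
rewrite sumrB; congr (_ - _); last first.
  by apply: eq_bigr => s _; rewrite /state_marginal mulr_suml.
under eq_bigr do under eq_bigr do rewrite mulrDr.
under eq_bigr do rewrite big_split.
rewrite big_split/=; congr (_ + _); last first.
  rewrite pair_big/= /mean mulr_sumr; apply: eq_bigr => -[s u] _ /=.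
  by rewrite mulrCA.
rewrite pair_big/=; under eq_bigr => x _ do rewrite mulr_sumr.
rewrite exchange_big/=; apply: eq_bigr => s' _.
rewrite /flow mulr_suml; apply: eq_bigr => -[s u] _ /=.
by rewrite mulrA.
Qed.

End Gibbs.

(** * Decomposition of the Lagrangian *)

Section Program.
Context (R : realType) (S U : finType) (K N : nat) (kappa : R)
  (Y : S * U -> R) (r : nat -> R) (w : 'I_N -> nat -> R)
  (T : nat -> S * U -> S -> R) (nu00 : S * U -> R) (phi0 : nat -> S -> U -> R).
Hypotheses (hK : (1 <= K)%N) (hkappa : 0 < kappa).
Hypothesis hT : forall k x, (k <= K)%N -> is_pmf (T k x).
Hypothesis hnu00 : is_pmf nu00.
Hypothesis hphi0 : forall k s, (1 <= k <= K)%N -> is_pmf (phi0 k s).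
Implicit Types (lam gam : 'rV[R]_N) (g : nat -> S -> R) (f : S -> R)
  (nu : nat -> S * U -> R).

Local Notation B := (bellman Y w T phi0).
Local Notation policy := (bellman_policy Y w T phi0).
Local Notation L := (lagrangian K kappa Y r w T phi0).
Local Notation objective := (objective K kappa phi0).

(** The Lagrangian contains no [g (K.+1)]: the last tilt is by the terminal
    condition zero, whatever [g] is beyond [K]. *)
Definition truncate g k s : R := if (k <= K)%N then g k s else 0.

Definition initial_flow s' : R := \sum_x nu00 x * T 0 x s'.

Definition dual_offset lam f : R :=
  \sum_n (lam ord0 n * rhat K w r n - lam ord0 n ^+ 2 / (2 * kappa))
  - \sum_s initial_flow s * f s.

Definition bellman_gap lam g nu : R :=
  \sum_(1 <= k < K.+1) \sum_s
    state_marginal (nu k) s * (g k s - B lam k (truncate g k.+1) s).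

Lemma flow_telescope g nu :
  nu 0%N =1 nu00 ->
  \sum_(1 <= k < K.+1) \sum_s flow T nu k.+1 s * truncate g k.+1 s
  - \sum_(1 <= k < K.+1) \sum_s flow T nu k s * g k s
  = - \sum_s initial_flow s * g 1%N s.
Proof.
move=> nu0; pose F k := \sum_s flow T nu k s * truncate g k s.
rewrite -sumrB (eq_big_nat _ _ (F2 := fun k => F k.+1 - F k)); last first.
  move=> k /andP[_ kK]; congr (_ - _).
  by apply: eq_bigr => s _; rewrite /truncate -ltnS kK.
rewrite telescope_sumr//.
have -> : F K.+1 = 0 by rewrite /F big1// => s _; rewrite /truncate ltnn mulr0.
rewrite sub0r; congr (- _); apply: eq_bigr => s _.
by rewrite /truncate hK; congr (_ * _); apply: eq_bigr => x _; rewrite nu0.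
Qed.

Lemma constraint_pairing lam gam nu :
  \sum_(n < N) lam ord0 n *
     (gam ord0 n + \sum_(1 <= k < K.+1) w n k * (r k - mean (nu k) Y))
  = \sum_(n < N) lam ord0 n * gam ord0 n
    + \sum_(n < N) lam ord0 n * rhat K w r n
    - \sum_(1 <= k < K.+1) lambda_check w lam k * mean (nu k) Y.
Proof.
rewrite /lambda_check.
under [X in _ = _ - X]eq_bigr do rewrite mulr_suml.
rewrite [X in _ = _ - X]exchange_big/= -big_split -sumrB/=; apply: eq_bigr => n _.
rewrite mulrDr -addrA; congr (_ + _).
under [X in _ = _ - X]eq_bigr do rewrite -mulrA.
rewrite -mulr_sumr -mulrBr /rhat -sumrB; congr (_ * _).
by apply: eq_bigr => k _; rewrite mulrBr.
Qed.

Lemma complete_square lam gam :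
  kappa / 2 * \sum_n (gam ord0 n + lam ord0 n / kappa) ^+ 2
  = kappa / 2 * \sum_n gam ord0 n ^+ 2 + \sum_n lam ord0 n * gam ord0 n
    + \sum_n lam ord0 n ^+ 2 / (2 * kappa).
Proof.
rewrite !mulr_sumr -!big_split/=; apply: eq_bigr => n _.
by field; rewrite lt0r_neq0.
Qed.

(** The divergences from the nominal policies become divergences from the tilted
    ones; everything else is a real number, compared by linear arithmetic once
    the flow terms have telescoped and the square in [gam] is completed. *)
Lemma lagrangian_decomposition lam gam g nu :
  admissible K nu00 nu ->
  L nu gam lam g
  = (\sum_(1 <= k < K.+1) divergence (policy lam k (truncate g k.+1)) (nu k)
     + (bellman_gap lam g nu
        + kappa / 2 * \sum_n (gam ord0 n + lam ord0 n / kappa) ^+ 2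
        + dual_offset lam (g 1%N))%R%:E)%E.
Proof.
move=> [nu0 hnu]; rewrite /lagrangian /Defs.objective.
under eq_big_nat => k kK.
  rewrite (@divergence_bellman _ _ _ _ Y w T phi0 lam k (truncate g k.+1) nu);
    [|exact: (hnu k kK).1|by move=> s; exact: hphi0].
  over.
rewrite big_split/= sumEFin -!addeA -!EFinD; congr (_ + _%:E)%E.
rewrite sumrB big_split/= constraint_pairing complete_square.
rewrite /dual_offset /bellman_gap sumrB.
under [X in _ = X + _ + _]eq_bigr do
  (under eq_bigr do rewrite mulrBr; rewrite sumrB).
rewrite sumrB.
under [X in _ + (_ + (_ + X)) = _]eq_bigr do
  (under eq_bigr do rewrite mulrBl; rewrite sumrB).
rewrite sumrB.
have := flow_telescope g nu0.
lra.
Qed.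

(** * Minimizers of the Lagrangian *)

Definition optimal_policy lam g k : S -> U -> R := policy lam k (truncate g k.+1).

Lemma optimal_policy_pmf lam g k s :
  (1 <= k <= K)%N -> is_pmf (optimal_policy lam g k s).
Proof. by move=> hk; apply: bellman_policy_pmf; exact: hphi0. Qed.

Lemma divergence_optimal_policy_ge0 lam g nu k :
  admissible K nu00 nu -> (1 <= k <= K)%N ->
  (0 <= divergence (optimal_policy lam g k) (nu k))%E.
Proof.
move=> [_ hnu] hk; apply: divergence_ge0; last exact: (hnu k hk).1.
by move=> s; exact: optimal_policy_pmf.
Qed.

Lemma sum_divergence_ge0 lam g nu :
  admissible K nu00 nu ->
  (0 <= \sum_(1 <= k < K.+1) divergence (optimal_policy lam g k) (nu k))%E.
Proof.
move=> hnu; rewrite big_nat; apply: sume_ge0 => k hk.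
exact: divergence_optimal_policy_ge0.
Qed.

Lemma square_penalty_ge0 lam gam :
  0 <= kappa / 2 * \sum_n (gam ord0 n + lam ord0 n / kappa) ^+ 2.
Proof.
apply: mulr_ge0; first by rewrite divr_ge0// ltW.
by apply: sumr_ge0 => n _; exact: sqr_ge0.
Qed.

Lemma lagrangian_ge lam gam g nu :
  admissible K nu00 nu ->
  ((bellman_gap lam g nu + dual_offset lam (g 1%N))%:E <= L nu gam lam g)%E.
Proof.
move=> hnu; rewrite lagrangian_decomposition//.
rewrite -[leLHS]add0e leeD ?sum_divergence_ge0// lee_fin lerD2r lerDl.
exact: square_penalty_ge0.
Qed.

Lemma lagrangian_minimizer lam g nu :
  admissible K nu00 nu -> has_policy K nu (optimal_policy lam g) ->
  L nu (- kappa^-1 *: lam) lam g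
  = (bellman_gap lam g nu + dual_offset lam (g 1%N))%:E.
Proof.
move=> hnu hpol; rewrite lagrangian_decomposition// big_nat big1 => [|k hk].
  rewrite add0e; congr (_%:E); rewrite big1 ?mulr0 ?addr0// => n _.
  by rewrite mxE mulNr mulrC addNr expr0n.
apply/divergence_eq0 => [s||s u]; last exact: hpol.
  exact: optimal_policy_pmf.
exact: (hnu.2 k hk).1.
Qed.

(** Equality leaves no room for a positive divergence at any time; this is the
    source of uniqueness of the optimal policy. *)
Lemma lagrangian_minimizer_policy lam gam g nu :
  admissible K nu00 nu ->
  L nu gam lam g = (bellman_gap lam g nu + dual_offset lam (g 1%N))%:E ->
  has_policy K nu (optimal_policy lam g).
Proof.
move=> hnu; rewrite lagrangian_decomposition// => e k s u hk.
have /sume_eq0 h0 :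
    (\sum_(1 <= k < K.+1) divergence (optimal_policy lam g k) (nu k) = 0)%E.
  have := sum_divergence_ge0 lam g hnu; have := square_penalty_ge0 lam gam.
  move: e; rewrite -/(optimal_policy _ _ _).
  case: (\sum_(_ <= _ < _) _)%E => [d|//|//] [] e q0.
  by rewrite lee_fin => d0; congr EFin; lra.
have : divergence (optimal_policy lam g k) (nu k) = 0%E.
  apply: h0; last by rewrite mem_index_iota.
  move=> j; rewrite mem_index_iota => hj.
  exact: divergence_optimal_policy_ge0.
move/divergence_eq0; apply=> [s'|]; first exact: optimal_policy_pmf.
exact: (hnu.2 k hk).1.
Qed.

Lemma some_state : S.
Proof.
have [[s _] _|S0] := pickP (fun _ : S * U => true); first exact: s.
exfalso; have /eqP := hnu00.2; rewrite big1 ?(eq_sym 0) ?oner_eq0//.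
by move=> x; have := S0 x.
Qed.

(** Without flow constraints the marginals at different times are independent, and
    the gap is linear in each: a point mass at a minimal state is best. *)
Lemma lagrangian_has_minimizer lam g :
  exists nu gam, admissible K nu00 nu /\
    forall nu' gam', admissible K nu00 nu' ->
      (L nu gam lam g <= L nu' gam' lam g)%E.
Proof.
pose c k s := g k s - B lam k (truncate g k.+1) s.
pose best k := [arg min_(s < some_state) c k s]%O.
have bestP k s : c k (best k) <= c k s.
  by rewrite /best; case: Order.TotalTheory.arg_minP => // i _; exact.
pose nu k x := if k == 0%N then nu00 x
  else optimal_policy lam g k x.1 x.2 * (x.1 == best k)%:R.
have marg k s : (1 <= k <= K)%N -> state_marginal (nu k) s = (s == best k)%:R.
  move=> hk; rewrite /state_marginal /nu gtn_eqF ?(andP hk).1//=.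
  by rewrite -mulr_suml (optimal_policy_pmf lam g s hk).2 mul1r.
have hnu : admissible K nu00 nu.
  split=> // k hk; split=> [x|].
    rewrite /nu gtn_eqF ?(andP hk).1// mulr_ge0//.
    exact: (optimal_policy_pmf lam g x.1 hk).1.
  rewrite -sum_state_marginal (eq_bigr _ (fun s _ => marg k s hk)).
  by rewrite (bigD1 (best k))//= eqxx big1 ?addr0// => s /negPf ->.
have hpol : has_policy K nu (optimal_policy lam g).
  by move=> k s u hk; rewrite marg// /nu gtn_eqF ?(andP hk).1.
exists nu, (- kappa^-1 *: lam); split=> // nu' gam' hnu'.
rewrite lagrangian_minimizer//; apply: le_trans (lagrangian_ge lam gam' g hnu').
rewrite lee_fin lerD2r /bellman_gap big_nat [leRHS]big_nat.
apply: ler_sum => k hk.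
have -> : \sum_s state_marginal (nu k) s * c k s = c k (best k).
  rewrite (bigD1 (best k))//= marg// eqxx mul1r big1 ?addr0// => s /negPf sb.
  by rewrite marg// sb mul0r.
have [nu'0 nu'1] := hnu'.2 k hk.
rewrite -[leLHS]mul1r -nu'1 -sum_state_marginal mulr_suml.
apply: ler_sum => s _; apply: ler_wpM2l; last exact: bestP.
exact: state_marginal_ge0.
Qed.

Lemma dual_function_attained lam g nu gam :
  admissible K nu00 nu ->
  (forall nu' gam', admissible K nu00 nu' ->
     L nu gam lam g <= L nu' gam' lam g)%E ->
  L nu gam lam g = dual_function K kappa Y r w T phi0 nu00 lam g.
Proof.
move=> hnu hmin; apply/eqP; rewrite eq_le; apply/andP; split.
  by apply: le_ereal_inf_tmp => _ [nu' [gam' [hnu' ->]]]; exact: hmin.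
by apply: ereal_inf_lbound; exists nu, gam.
Qed.

Lemma dual_function_le lam g nu gam :
  admissible K nu00 nu ->
  (dual_function K kappa Y r w T phi0 nu00 lam g <= L nu gam lam g)%E.
Proof. by move=> hnu; apply: ereal_inf_lbound; exists nu, gam. Qed.

(** * Closed loops and the Lagrangian along the flow *)

Definition satisfies_flow nu :=
  forall k s', (1 <= k <= K)%N -> state_marginal (nu k) s' = flow T nu k s'.

Fixpoint propagate (q : nat -> S -> U -> R) k : S * U -> R :=
  if k is k'.+1 then
    fun x => q k x.1 x.2 * \sum_y propagate q k' y * T k' y x.1
  else nu00.

Lemma propagate_marginal q k s :
  is_pmf (q k.+1 s) ->
  state_marginal (propagate q k.+1) s = flow T (propagate q) k.+1 s.
Proof. by move=> hq; rewrite /state_marginal /= -mulr_suml hq.2 mul1r. Qed.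

Lemma propagate_pmf q k :
  (forall k s, (1 <= k <= K)%N -> is_pmf (q k s)) -> (k <= K)%N ->
  is_pmf (propagate q k).
Proof.
move=> hq; elim: k => [//|k IH] kK; have [IH0 IH1] := IH (ltnW kK).
split=> [x|].
  rewrite mulr_ge0 ?(hq _ _ _).1//= sumr_ge0// => y _.
  by rewrite mulr_ge0// (hT _ (ltnW kK)).1.
rewrite -sum_state_marginal.
under eq_bigr do (rewrite propagate_marginal; last exact: hq).
rewrite exchange_big/= -[RHS]IH1; apply: eq_bigr => x _.
by rewrite -mulr_sumr (hT _ (ltnW kK)).2 mulr1.
Qed.

Lemma propagateP q :
  (forall k s, (1 <= k <= K)%N -> is_pmf (q k s)) ->
  [/\ admissible K nu00 (propagate q), has_policy K (propagate q) q
    & satisfies_flow (propagate q)].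
Proof.
move=> hq; have flowq : satisfies_flow (propagate q).
  by move=> [//|k] s hk; apply: propagate_marginal; exact: hq.
split=> //.
  by split=> // k /andP[_ kK]; exact: propagate_pmf.
by move=> [//|k] s u hk; rewrite flowq.
Qed.

Lemma lagrangian_flow nu gam lam g :
  satisfies_flow nu ->
  L nu gam lam g
  = (objective nu gam
     + (\sum_(n < N) lam ord0 n *
        (gam ord0 n + \sum_(1 <= k < K.+1) w n k * (r k - mean (nu k) Y)))%R%:E)%E.
Proof.
move=> hf; rewrite /lagrangian [X in (_ + X%:E)%E](_ : _ = 0) ?adde0//.
rewrite big_nat big1// => k hk; rewrite big1// => s _.
by rewrite hf// subrr mul0r.
Qed.

Definition residual nu gam n : R :=
  gam ord0 n + \sum_(1 <= k < K.+1) w n k * (r k - mean (nu k) Y).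

Lemma residualE nu gam n :
  residual nu gam n
  = gam ord0 n - (\sum_(1 <= k < K.+1) w n k * mean (nu k) Y - rhat K w r n).
Proof.
rewrite /residual opprB /rhat -sumrB; congr (_ + _).
by apply: eq_bigr => k _; rewrite mulrBr.
Qed.

Lemma feasible_lagrangian nu gam lam g :
  feasible K Y r w T nu00 nu gam -> L nu gam lam g = objective nu gam.
Proof.
move=> [_ hg hf]; rewrite lagrangian_flow// big1 ?adde0// => n _.
by rewrite -/(residual nu gam n) residualE -hg subrr mulr0.
Qed.

(** Along the flow the multipliers [g] and [g'] are multiplied by zero, so they may
    be chosen differently on the two sides. *)
Lemma lagrangian_shift nu gam lam g (d : 'rV[R]_N) g' :
  satisfies_flow nu ->
  L nu gam (lam + d) g'
  = (L nu gam lam g + (\sum_n d ord0 n * residual nu gam n)%R%:E)%E.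
Proof.
move=> hf; rewrite !lagrangian_flow// -[RHS]addeA -EFinD -big_split/=.
by congr (_ + _%:E)%E; apply: eq_bigr => n _; rewrite mxE mulrDl.
Qed.

(** * The backward recursion and the reduced dual *)

(** Indexed by the number [j] of remaining steps, so that the recursion is
    structural; the step that leaves [j] steps to go is the one at time [K - j]. *)
Fixpoint cost_to_go lam j : S -> R :=
  if j is j'.+1 then B lam (K - j') (cost_to_go lam j') else fun=> 0.

Definition value lam k : S -> R := cost_to_go lam (K.+1 - k).

Lemma value_terminal lam s : value lam K.+1 s = 0.
Proof. by rewrite /value subnn. Qed.

Lemma value_bellman lam k s :
  (1 <= k <= K)%N -> value lam k s = B lam k (value lam k.+1) s.
Proof.
by move=> /andP[k1 kK]; rewrite /value subSn// subSS /= subKn.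
Qed.

Lemma truncate_value lam k : (k <= K)%N ->
  truncate (value lam) k.+1 = value lam k.+1.
Proof.
move=> kK; apply/funext => s; rewrite /truncate; case: ltnP => // Kk.
by rewrite (_ : k = K) ?value_terminal//; apply/eqP; rewrite eqn_leq kK.
Qed.

Lemma bellman_gap_value lam nu : bellman_gap lam (value lam) nu = 0.
Proof.
rewrite /bellman_gap big_nat big1// => k hk; rewrite big1// => s _.
have [_ kK] := andP hk.
by rewrite truncate_value// (value_bellman lam s hk) subrr mulr0.
Qed.

Definition closed_loop lam : nat -> S * U -> R :=
  propagate (optimal_policy lam (value lam)).

Lemma closed_loopP lam :
  [/\ admissible K nu00 (closed_loop lam),
    has_policy K (closed_loop lam) (optimal_policy lam (value lam))
    & satisfies_flow (closed_loop lam)].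
Proof. by apply: propagateP => k s; exact: optimal_policy_pmf. Qed.

Definition reduced_dual lam : R := dual_offset lam (value lam 1).

Lemma lagrangian_closed_loop lam :
  L (closed_loop lam) (- kappa^-1 *: lam) lam (value lam)
  = (reduced_dual lam)%:E.
Proof.
have [adm pol _] := closed_loopP lam.
by rewrite lagrangian_minimizer// bellman_gap_value add0r.
Qed.

Lemma lagrangian_value_ge lam nu gam :
  admissible K nu00 nu -> ((reduced_dual lam)%:E <= L nu gam lam (value lam))%E.
Proof.
by move=> hnu; have := lagrangian_ge lam gam (value lam) hnu;
  rewrite bellman_gap_value add0r.
Qed.

Lemma dual_function_value lam :
  dual_function K kappa Y r w T phi0 nu00 lam (value lam)
  = (reduced_dual lam)%:E.
Proof.
have [adm pol _] := closed_loopP lam.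
rewrite -lagrangian_closed_loop; apply/esym/dual_function_attained => //.
by move=> nu gam hnu; rewrite lagrangian_closed_loop; exact: lagrangian_value_ge.
Qed.

(** By the envelope principle this is the partial derivative of
    [reduced_dual] in the direction [n]. *)
Definition dual_gradient n lam : R :=
  residual (closed_loop lam) (- kappa^-1 *: lam) n.

(** The closed loop of [lam + d] attains the dual value there and competes in the
    minimum at [lam]; the two Lagrangians differ by a linear term in [d]. *)
Lemma reduced_dual_superdifferential lam (d : 'rV[R]_N) :
  reduced_dual lam + \sum_n d ord0 n * dual_gradient n (lam + d)
  <= reduced_dual (lam + d).
Proof.
have [adm _ fl] := closed_loopP (lam + d).
rewrite -lee_fin EFinD -[leRHS]lagrangian_closed_loop.
rewrite (lagrangian_shift _ lam (value lam) d _ fl).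
by rewrite leeD2r// lagrangian_value_ge.
Qed.

(** Competitor in the minimum at [lam]: the closed loop of the zero multiplier
    with [gam = - lam / kappa], whose Lagrangian is a quadratic in [lam]. *)
Lemma reduced_dual_coercive lam :
  reduced_dual lam
  <= reduced_dual 0
     + \sum_n (lam ord0 n * residual (closed_loop 0) 0 n
                - lam ord0 n ^+ 2 / (2 * kappa)).
Proof.
have [adm pol fl] := closed_loopP 0.
have := lagrangian_value_ge lam (- kappa^-1 *: lam) adm.
rewrite -[X in L _ _ X _]add0r (lagrangian_shift _ 0 (value 0) _ _ fl).
rewrite lagrangian_decomposition// big_nat big1 => [|k hk]; last first.
  apply/divergence_eq0 => [s||s u]; last exact: pol.
    exact: optimal_policy_pmf.
  exact: (adm.2 k hk).1.
rewrite add0e bellman_gap_value -EFinD lee_fin => /le_trans; apply.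
rewrite add0r -/(reduced_dual 0) addrAC addrC lerD2l mulr_sumr -big_split/=.
apply: ler_sum => n _; rewrite /residual !mxE.
set x := \sum_(_ <= _ < _) _.
rewrite le_eqVlt; apply/orP; left; apply/eqP; field.
by rewrite lt0r_neq0.
Qed.

(** * Continuity in the multiplier and existence of a stationary point *)

Lemma tilt_continuous k (f : 'rV[R]_N -> S -> R) s u :
  (forall s', continuous (fun lam => f lam s')) ->
  continuous (fun lam => tilt Y w T lam k (f lam) s u).
Proof.
move=> cf; apply: addr_continuous.
  apply: sumr_continuous => s'; apply: mulr_continuous => //.
  exact: cst_continuous.
apply: mulr_continuous; last exact: cst_continuous.
apply: sumr_continuous => n; apply: mulr_continuous; last exact: cst_continuous.
exact: coord_continuous.
Qed.

Lemma bellman_continuous k (f : 'rV[R]_N -> S -> R) s :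
  (1 <= k <= K)%N -> (forall s', continuous (fun lam => f lam s')) ->
  continuous (fun lam => B lam k (f lam) s).
Proof.
move=> hk cf; apply: ln_comp_continuous => [lam|].
  by apply: (partition_gt0 (tilt Y w T lam k (f lam) s)); exact: hphi0.
apply: sumr_continuous => u; apply: mulr_continuous; first exact: cst_continuous.
by apply: expR_comp_continuous; exact: tilt_continuous.
Qed.

(** Restricted to [1 <= k], since [phi0 0] need not be a pmf and the logarithm in
    the Bellman operator at time [0] might be taken at a nonpositive number. *)
Lemma value_continuous k s :
  (1 <= k)%N -> continuous (fun lam => value lam k s).
Proof.
move=> k1; rewrite /value.
have : (K.+1 - k <= K)%N by rewrite leq_subLR -add1n leq_add2r.
elim: (K.+1 - k)%N s => [|j IH] s jK /=; first exact: cst_continuous.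
apply: bellman_continuous; last by move=> s'; exact: IH (ltnW jK).
by rewrite subn_gt0 jK leq_subr.
Qed.

Lemma optimal_policy_value_continuous k s u :
  (1 <= k <= K)%N ->
  continuous (fun lam => optimal_policy lam (value lam) k s u).
Proof.
move=> hk; have [_ kK] := andP hk.
have -> : (fun lam => optimal_policy lam (value lam) k s u)
    = (fun lam => policy lam k (value lam k.+1) s u).
  by apply/funext => lam; rewrite /optimal_policy truncate_value.
have cv s' : continuous (fun lam => value lam k.+1 s') by exact: value_continuous.
apply: mulr_continuous; first exact: cst_continuous.
apply: expR_comp_continuous; apply: addr_continuous; first exact: tilt_continuous.
by apply: oppr_continuous; exact: bellman_continuous.
Qed.

Lemma closed_loop_continuous k x :
  (k <= K)%N -> continuous (fun lam => closed_loop lam k x).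
Proof.
elim: k x => [|k IH] x kK; first exact: cst_continuous.
apply: mulr_continuous; first exact: optimal_policy_value_continuous.
apply: sumr_continuous => y; apply: mulr_continuous; last exact: cst_continuous.
exact: IH (ltnW kK).
Qed.

Lemma dual_gradient_continuous n : continuous (dual_gradient n).
Proof.
apply: addr_continuous.
  have -> : (fun lam : 'rV[R]_N => (- kappa^-1 *: lam) ord0 n)
      = (fun lam => - kappa^-1 * lam ord0 n).
    by apply/funext => lam; rewrite mxE.
  by apply: mulr_continuous; [exact: cst_continuous|exact: coord_continuous].
have -> : (fun lam => \sum_(1 <= k < K.+1)
         w n k * (r k - mean (closed_loop lam k) Y))
    = (fun lam => \sum_(1 <= k < K.+1)
         if (k <= K)%N then w n k * (r k - mean (closed_loop lam k) Y) else 0).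
  apply/funext => lam; apply: eq_big_nat => k /andP[_ kK].
  by rewrite -ltnS kK.
apply: sumr_continuous => k; case: (boolP (k <= K)%N) => [kK|_].
  apply: mulr_continuous; first exact: cst_continuous.
  apply: addr_continuous; first exact: cst_continuous.
  apply: oppr_continuous; apply: sumr_continuous => x.
  apply: mulr_continuous; last exact: cst_continuous.
  exact: closed_loop_continuous.
exact: cst_continuous.
Qed.

Lemma reduced_dual_continuous : continuous reduced_dual.
Proof.
apply: addr_continuous.
  have ccoord n : continuous (fun lam : 'rV[R]_N => lam ord0 n).
    exact: coord_continuous.
  apply: sumr_continuous => n; apply: addr_continuous.
    by apply: mulr_continuous => //; exact: cst_continuous.
  apply: oppr_continuous; apply: mulr_continuous; last exact: cst_continuous.
  exact: mulr_continuous.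
apply: oppr_continuous; apply: sumr_continuous => s.
by apply: mulr_continuous; [exact: cst_continuous|exact: value_continuous].
Qed.

Lemma exists_stationary : exists lam, forall n, dual_gradient n lam = 0.
Proof.
have [|lam lam_max] :=
  coercive_attains_max _ reduced_dual_continuous reduced_dual_coercive.
  by rewrite mulr_gt0.
exists lam; apply: continuous_stationary; first exact: dual_gradient_continuous.
move=> d; rewrite -(lerD2l (reduced_dual lam)) addr0.
by apply: le_trans (lam_max (lam + d)); exact: reduced_dual_superdifferential.
Qed.

(** * Strong duality *)

Lemma closed_loop_feasible lam :
  (forall n, dual_gradient n lam = 0) ->
  feasible K Y r w T nu00 (closed_loop lam) (- kappa^-1 *: lam).
Proof.
move=> h; have [adm _ fl] := closed_loopP lam; split=> // n.
by have /eqP := h n; rewrite /dual_gradient residualE subr_eq0 => /eqP.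
Qed.

Lemma weak_duality lam g nu gam :
  feasible K Y r w T nu00 nu gam ->
  (dual_function K kappa Y r w T phi0 nu00 lam g <= objective nu gam)%E.
Proof.
move=> hf; rewrite -(feasible_lagrangian lam g hf).
by apply: dual_function_le; case: hf.
Qed.

Lemma closed_loop_optimal lam :
  (forall n, dual_gradient n lam = 0) ->
  objective (closed_loop lam) (- kappa^-1 *: lam) = (reduced_dual lam)%:E /\
  primal_value K kappa Y r w T phi0 nu00 = (reduced_dual lam)%:E.
Proof.
move=> /closed_loop_feasible hf.
have obj : objective (closed_loop lam) (- kappa^-1 *: lam) = (reduced_dual lam)%:E.
  by rewrite -(feasible_lagrangian lam (value lam) hf) lagrangian_closed_loop.
split=> //; apply/eqP; rewrite eq_le; apply/andP; split.
  rewrite -obj; apply: ereal_inf_lbound.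
  by exists (closed_loop lam), (- kappa^-1 *: lam).
apply: le_ereal_inf_tmp => _ [nu [gam [hnu ->]]].
by rewrite -dual_function_value; exact: weak_duality.
Qed.

Lemma tilted_policy_value lam k s u : (1 <= k <= K)%N ->
  tilted_policy Y w T phi0 lam (value lam) k s u
  = optimal_policy lam (value lam) k s u.
Proof.
move=> hk; have [_ kK] := andP hk.
rewrite /optimal_policy truncate_value//; apply: tilted_policyE.
exact: value_bellman.
Qed.

End Program.

Theorem theorem2p1 (R : realType) (S U : finType) (K N : nat)
    (hK : (1 <= K)%N) (hN : (1 <= N)%N)
    (kappa : R) (hkappa : 0 < kappa)
    (Y : S * U -> R) (r : nat -> R) (w : 'I_N -> nat -> R)
    (T : nat -> S * U -> S -> R)
    (hT : forall k x, (k <= K)%N -> is_pmf (T k x))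
    (nu00 : S * U -> R) (hnu00 : is_pmf nu00)
    (phi0 : nat -> S -> U -> R)
    (hphi0 : forall k s, (1 <= k <= K)%N -> is_pmf (phi0 k s)) :
  (* the minimum defining the dual function is attained *)
  (forall (lam : 'rV[R]_N) (g : nat -> S -> R),
     exists (nu : nat -> S * U -> R) (gam : 'rV[R]_N),
       admissible K nu00 nu /\
       lagrangian K kappa Y r w T phi0 nu gam lam g
         = dual_function K kappa Y r w T phi0 nu00 lam g)
  /\
  exists (lam : 'rV[R]_N) (g : nat -> S -> R),
    (* (lam, g) maximizes the dual function *)
    (forall (lam' : 'rV[R]_N) (g' : nat -> S -> R),
       (dual_function K kappa Y r w T phi0 nu00 lam' g'
          <= dual_function K kappa Y r w T phi0 nu00 lam g)%E) /\
    (* no duality gap *)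
    dual_function K kappa Y r w T phi0 nu00 lam g
      = primal_value K kappa Y r w T phi0 nu00 /\
    (* backward recursion *)
    (forall s, g K.+1 s = 0) /\
    (forall k s, (1 <= k <= K)%N ->
       g k s = bellman Y w T phi0 lam k (g k.+1) s) /\
    (* the tilted policy is a policy, the primal minimum is attained, and
       every primal optimizer has the tilted policy *)
    (forall k s, (1 <= k <= K)%N ->
       is_pmf (tilted_policy Y w T phi0 lam g k s)) /\
    (exists (nu : nat -> S * U -> R) (gam : 'rV[R]_N),
       primal_optimal K kappa Y r w T phi0 nu00 nu gam) /\
    (forall (nu : nat -> S * U -> R) (gam : 'rV[R]_N),
       primal_optimal K kappa Y r w T phi0 nu00 nu gam ->
       has_policy K nu (tilted_policy Y w T phi0 lam g)).
Proof.
split=> [lam g|].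
  have [nu [gam [hnu hmin]]] :=
    lagrangian_has_minimizer Y r w T hK hkappa hnu00 hphi0 lam g.
  exists nu, gam; split=> //; exact: dual_function_attained.
have [lam hlam] := exists_stationary Y r w hK hkappa hT hnu00 hphi0.
have feas := closed_loop_feasible hT hnu00 hphi0 hlam.
have [obj primal] := closed_loop_optimal hK hkappa hT hnu00 hphi0 hlam.
have dual := dual_function_value Y r w hK hkappa hT hnu00 hphi0 lam.
have policyE k s u := @tilted_policy_value _ _ _ K N Y w T phi0 lam k s u.
exists lam, (value K Y w T phi0 lam).
split; [|split; [|split; [|split; [|split; [|split]]]]].
- by move=> lam' g'; rewrite dual -obj; exact: weak_duality.
- by rewrite dual primal.
- exact: value_terminal.
- by move=> k s; exact: value_bellman.
- move=> k s hk.
  have -> : tilted_policy Y w T phi0 lam (value K Y w T phi0 lam) k s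
    = optimal_policy K Y w T phi0 lam (value K Y w T phi0 lam) k s.
    by apply/funext => u; exact: policyE.
  exact: optimal_policy_pmf.
- exists (closed_loop K Y w T nu00 phi0 lam), (- kappa^-1 *: lam).
  by split=> //; rewrite primal.
- move=> nu gam [hf opt] k s u hk; rewrite policyE//.
  have [adm _ _] := hf.
  apply: (lagrangian_minimizer_policy (r := r) (gam := gam)
    hK hkappa hphi0 adm) => //.
  by rewrite (feasible_lagrangian _ _ _ _ hf) opt primal bellman_gap_value add0r.
Qed.
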